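(* Let $G$ be a finite simple connected planar graph with a fixed planar embedding, and let $G^*$ be its dual. Consider the pure coordination game on $G$ with two strategies. Then $s\in C(G^* )$ satisfies \[ \mathrm{size}(s)\le \mathrm{size}(r)\qquad\text{for all } r\in\Gamma_C(s):=\{r\in C(G^* ): d_C(s,r)\le 1\} \] if and only if $\Phi^{-1}\circ\Psi^{-1}s\in\mathcal{A}_G^{(2)}$ is a Nash equilibrium.
   Context: Game. $G=(V,E)$ has adjacency matrix $W$. A strategy profile is a map $u:V\to\{1,2\}$. The payoff to player $v$ for playing $i$ against $u$ is $w_v(i|u)=\sum_{x\in V}W_{v,x}\,\delta(i,u_x)$ ($\delta$ the Kronecker delta). $u$ is a Nash equilibrium if $w_v(u_v|u)\ge w_v(i|u)$ for all $v\in V$, $i\in\{1,2\}$. $\Phi$ sends $u$ to the partition of $V$ whose parts are the sets of vertices using the same strategy; $\mathcal{A}_G^{(2)}$ is the set of equivalence classes of two-strategy profiles with the same image under $\Phi$ (i.e. profiles up to swapping the two strategies). A class is called a Nash equilibrium if one (equivalently every) profile in it is. $\mathcal{Q}_G^{(2)}$ is the set of partitions of $V$ into two parts (one part may be empty), so $\Phi:\mathcal{A}_G^{(2)}\to\mathcal{Q}_G^{(2)}$ is a bijection. Dual. Edges $e$ of $G$ correspond bijectively to edges $e^*$ of $G^*$ (possibly a multigraph), and vertices of $G$ to faces of $G^*$. $C(G^* )$ is the cycle space of $G^*$: the set of subgraphs (identified with edge sets) in which every vertex has even degree, a vector space over $\mathbb{Z}_2$ under symmetric difference. $\Psi:\mathcal{Q}_G^{(2)}\to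 C(G^* )$ sends a partition $P$ to the subgraph spanned by the edges $e^*$ with $e$ in the cutset of $P$ (i.e. $e$ joins the two parts); it is a bijection. $\mathrm{size}(s)$ is the number of edges of $s$. Metric. A cycle single face rewiring (CSFR) from $s$ to $r$ is a change for which there is a single face $f$ of $G^*$ such that edges not incident to $f$ are in $s$ iff they are in $r$, and edges incident to $f$ are in $s$ iff they are not in $r$ (i.e. $r=s+C_f$ over $\mathbb{Z}_2$, with $C_f$ the set of edges incident to $f$). $d_C(s,r)$ is the minimum number of CSFRs needed to go from $s$ to $r$. *)

(* Defs.v *)
From mathcomp Require Import all_boot all_fingroup.
Set Implicit Arguments.
Unset Strict Implicit.
Unset Printing Implicit Defensive.

(** * Finite simple graphs *)

Record sgraph := SGraph {
  vertex :> finType;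
  adj : rel vertex;
  adj_sym : symmetric adj;
  adj_irrefl : irreflexive adj
}.

Definition connected_graph (G : sgraph) : Prop :=
  0 < #|G| /\ forall x y : G, connect (@adj G) x y.

Definition graph_edges (G : sgraph) : {set {set G}} :=
  [set [set p.1; p.2] | p : G * G & adj p.1 p.2].

(** * The pure coordination game with two strategies *)

Section Game.
Variable G : sgraph.

(* The strategies 1, 2 are the two elements of 'I_2. *)
Definition profile := {ffun G -> 'I_2}.

Definition adjacency (v x : G) : nat := adj v x.

Definition payoff (v : G) (i : 'I_2) (u : profile) : nat :=
  \sum_(x : G) adjacency v x * (i == u x).

Definition nash (u : profile) : Prop :=
  forall (v : G) (i : 'I_2), payoff v i u <= payoff v (u v) u.

(* A partition of V into two possibly empty parts is the set of its two parts,
   so that the trivial one is [set set0; setT] (MathComp's [partition] would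
   exclude the empty part). *)
Definition Q2 : {set {set {set G}}} := [set [set A; ~: A] | A : {set G}].

Definition strategy_partition (u : profile) : {set {set G}} :=
  [set [set v | u v == i] | i : 'I_2].

Definition A2 : {set {set profile}} :=
  preim_partition strategy_partition [set: profile].

Definition nash_class (c : {set profile}) : Prop :=
  exists2 u : profile, u \in c & nash u.

(* Phi maps a class in A2 to the common value of [strategy_partition] on it;
   the inverse of Phi therefore sends a partition to its fibre
   (see [Phi_inv_A2] and [A2_Phi_inv]). *)
Definition Phi_inv (P : {set {set G}}) : {set profile} :=
  strategy_partition @^-1: [set P].

Lemma strategy_partitionE (u : profile) :
  strategy_partition u = [set [set v | u v == ord0]; ~: [set v | u v == ord0]].
Proof.
have -> : ~: [set v | u v == ord0] = [set v | u v == ord_max].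
  by apply/setP=> v; rewrite !inE; case: (u v) => [[|[|k]] hk].
apply/setP=> B; rewrite !inE; apply/imsetP/orP.
  case=> -[[|[|k]] hk] _ -> //; [left|right]; apply/eqP/setP => v;
  by rewrite !inE -!val_eqE.
by case=> /eqP ->; [exists ord0|exists ord_max].
Qed.

Lemma strategy_partition_surj (P : {set {set G}}) :
  P \in Q2 -> exists u, strategy_partition u = P.
Proof.
case/imsetP=> A _ ->.
exists [ffun v => if v \in A then ord0 else ord_max].
have E : [set v | [ffun v => if v \in A then ord0 else ord_max : 'I_2] v == ord0] = A.
  by apply/setP=> v; rewrite !inE ffunE; case: ifP.
by rewrite strategy_partitionE E.
Qed.

Lemma Phi_inv_A2 (P : {set {set G}}) : P \in Q2 -> Phi_inv P \in A2.
Proof.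
case/strategy_partition_surj=> u <-; apply/imsetP; exists u => //.
by apply/setP=> u'; rewrite !inE eq_sym.
Qed.

Lemma A2_Phi_inv (c : {set profile}) :
  c \in A2 -> exists2 P, P \in Q2 & c = Phi_inv P.
Proof.
case/imsetP=> u _ ->; exists (strategy_partition u).
  by rewrite strategy_partitionE; apply/imsetP; exists [set v | u v == ord0].
by apply/setP=> u'; rewrite !inE eq_sym.
Qed.

(* The edges that meet two different parts of P. *)
Definition cutset (P : {set {set G}}) : {set {set G}} :=
  [set e in graph_edges G |
    [exists A in P, exists B in P,
      [&& A != B, A :&: e != set0 & B :&: e != set0]]].

End Game.

(** * Combinatorial maps: multigraphs embedded in an oriented surface *)

(* A dart is an oriented edge, [drev] reverses it, and [node] sends a dart to
   the next one around its origin. *)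
Record cmap := CMap {
  dart : finType;
  node : {perm dart};
  drev : dart -> dart;
  drevK : involutive drev;
  drev_neq : forall d, drev d != d
}.

Section CMap.
Variable M : cmap.
Implicit Types (s r : {set {set dart M}}).

Lemma face_inj : injective (fun d : dart M => node M (drev d)).
Proof. exact: inj_comp perm_inj (inv_inj (@drevK M)). Qed.

(* The next dart along the boundary of the face on one side of a dart. *)
Definition face : {perm dart M} := perm face_inj.

(* A connected map without darts is an isolated vertex: it has one vertex and
   one face, neither of which carries any dart. *)
Definition cells (p : {perm dart M}) : {set {set dart M}} :=
  if porbits p == set0 then [set set0] else porbits p.

Definition map_vertices : {set {set dart M}} := cells (node M).
Definition map_faces : {set {set dart M}} := cells face.

Definition map_edge (d : dart M) : {set dart M} := [set d; drev d].
Definition map_edges : {set {set dart M}} := [set map_edge d | d : dart M].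

(* Counting darts rather than edges makes a loop contribute 2. *)
Definition degree s (x : {set dart M}) : nat := #|[set d in x | map_edge d \in s]|.

Definition cycle_space : {set {set {set dart M}}} :=
  [set s : {set {set dart M}} |
    (s \subset map_edges) && [forall x in map_vertices, ~~ odd (degree s x)]].

Definition incident (e f : {set dart M}) : bool := e :&: f != set0.

Definition csfr : rel {set {set dart M}} := fun s r =>
  [&& s \in cycle_space, r \in cycle_space &
    [exists f in map_faces, forall e in map_edges,
      if incident e f then (e \in s) == (e \notin r)
      else (e \in s) == (e \in r)]].

Definition csfr_walk (n : nat) s r : bool :=
  [exists p : n.-tuple {set {set dart M}}, path csfr s p && (last s p == r)].

(* The least length of a walk from s to r. A shortest walk does not repeat an
   edge set, so its length is less than the number of edge sets; this number is
   the value when there is no walk. *)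
Definition dC s r : nat :=
  find (fun n => csfr_walk n s r) (iota 0 #|{set {set dart M}}|).

Definition GammaC s : {set {set {set dart M}}} :=
  [set r in cycle_space | dC s r <= 1].

End CMap.

(* The same darts, with the roles of vertices and faces exchanged: the face
   permutation of the dual is the node permutation of M. *)
Definition dual_map (M : cmap) : cmap := CMap (face M) (@drevK M) (@drev_neq M).

Lemma face_dual_map (M : cmap) : face (dual_map M) = node M.
Proof. by apply/permP=> d; rewrite permE /= permE /= drevK. Qed.

(** * Planar embeddings *)

Section Embedding.
Variable G : sgraph.

Definition gdart : finType := {p : G * G | adj p.1 p.2}.
Definition gtail (d : gdart) : G := (val d).1.
Definition ghead (d : gdart) : G := (val d).2.

Lemma grev_subproof (d : gdart) : adj (ghead d) (gtail d).
Proof. by rewrite adj_sym; exact: (valP d). Qed.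

Definition grev (d : gdart) : gdart :=
  Sub (ghead d, gtail d) (grev_subproof d).

Lemma grevK : involutive grev.
Proof. by move=> d; apply: val_inj; case: d => -[]. Qed.

Lemma grev_neq (d : gdart) : grev d != d.
Proof.
apply/eqP=> /(congr1 val) /= E; have := grev_subproof d.
by rewrite (congr1 fst E : ghead d = gtail d) adj_irrefl.
Qed.

Definition rotation_map (rot : {perm gdart}) : cmap := CMap rot grevK grev_neq.

(* An embedding of a connected graph in an oriented closed surface amounts to a
   cyclic order of the darts leaving each vertex; the surface is the sphere
   exactly when Euler's formula holds. *)
Record planar_embedding := PlanarEmbedding {
  rotation : {perm gdart};
  rotationP : forall d : gdart, porbit rotation d = [set d' | gtail d' == gtail d];
  eulerP : #|G| + #|map_faces (rotation_map rotation)| = #|graph_edges G| + 2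
}.

End Embedding.

Section Dual.
Variables (G : sgraph) (pi : planar_embedding G).

Definition dual_graph : cmap := dual_map (rotation_map (rotation pi)).

(* The edge e^* of the dual is made of the two darts carried by e. *)
Definition dual_edge (e : {set G}) : {set dart dual_graph} :=
  [set d : gdart G | [set gtail d; ghead d] == e].

Definition Psi (P : {set {set G}}) : {set {set dart dual_graph}} :=
  [set dual_edge e | e in cutset P].

(* When G is connected, Psi is a bijection from Q2 to the cycle space of the
   dual, and the default value is not used on the cycle space. *)
Definition Psi_inv (s : {set {set dart dual_graph}}) : {set {set G}} :=
  odflt [set set0; setT] [pick P in Q2 G | Psi P == s].

End Dual.

(* Main.v *)
(** Over F_2, let D be the vertex-edge incidence matrix of G and B the edge-face
    incidence matrix of the embedding. Then D B = 0; since G and its dual are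
    connected, rank D >= |V| - 1 and rank B >= |F| - 1, so Euler's formula
    |V| + |F| = |E| + 2 forces ker B = im D: every element of the cycle space of
    the dual is the dual of a cut. A rewiring around the face of the dual that
    corresponds to a vertex v moves v to the other side of the cut, and changes
    the size of the cut by the number of neighbours of v on its own side minus
    the number on the opposite side, that is, by the payoff of v minus the
    payoff it would get by deviating. *)

Require Import Defs.
From mathcomp Require Import all_boot all_fingroup.
From mathcomp Require Import all_algebra.

Set Implicit Arguments.
Unset Strict Implicit.
Unset Printing Implicit Defensive.

Import GRing.Theory.

(** * Exactness of a complex over a field by counting dimensions *)

Section Exactness.
Local Open Scope ring_scope.

(** Every row of the left kernel is constant, so the kernel lies in the line spanned by the all-ones
    row and has dimension at most 1. *)
Lemma rank_lower_bound (K : fieldType) (m n : nat) (A : 'M[K]_(m, n)) :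
    (forall u : 'rV_m, u *m A = 0 -> forall i j, u 0 i = u 0 j) ->
  (m <= \rank A + 1)%N.
Proof.
move=> kerA; have: (kermx A <= (const_mx 1 : 'rV[K]_m))%MS.
  apply/row_subP=> k; have /kerA Ek : row k (kermx A) *m A = 0.
    by apply/sub_kermxP; apply: row_sub.
  move: (row k _) Ek => u Eu; case: m u Eu {k A kerA} => [|m] u Eu.
    by rewrite (_ : u = 0) ?sub0mx //; apply/rowP=> -[].
  apply/sub_rVP; exists (u 0 0); apply/rowP=> j.
  by rewrite !mxE mulr1; apply: Eu.
move=> /mxrankS; rewrite mxrank_ker => /leq_trans/(_ (rank_leq_row _)).
by rewrite leq_subLR.
Qed.

(* The two kernel hypotheses bound the ranks of D and B from below by
   #|V| - 1 and #|F| - 1, so the dimension count makes the complex exact. *)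
Lemma exact_of_card (K : fieldType) (V T U : finType) (E : {set T})
    (F : {set U}) (D : V -> T -> K) (B : T -> U -> K) :
    {in F, forall f v, \sum_(e in E) D v e * B e f = 0} ->
    (forall a : V -> K, {in E, forall e, \sum_v a v * D v e = 0} ->
      forall x y, a x = a y) ->
    (forall b : U -> K, {in E, forall e, \sum_(f in F) B e f * b f = 0} ->
      {in F &, forall f g, b f = b g}) ->
    (#|E| + 2 <= #|V| + #|F|)%N ->
  forall c : T -> K, {in F, forall f, \sum_(e in E) c e * B e f = 0} ->
  exists a : V -> K, {in E, forall e, c e = \sum_v a v * D v e}.
Proof.
move=> DB kerD kerB EVF c cB.
pose MD := \matrix_(i < #|V|, j < #|E|) D (enum_val i) (enum_val j).
pose MB := \matrix_(i < #|E|, j < #|F|) B (enum_val i) (enum_val j).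
have sumV (h : V -> K) : \sum_v h v = \sum_(i < #|V|) h (enum_val i).
  exact: big_enum_val.
have MDB : MD *m MB = 0.
  apply/matrixP=> i j; rewrite !mxE.
  under eq_bigr do rewrite !mxE.
  rewrite -(big_enum_val (fun e => D (enum_val i) e * B e (enum_val j))).
  exact/DB/enum_valP.
have rkD : (#|V| <= \rank MD + 1)%N.
  apply: rank_lower_bound => u uD i j.
  pose a v := u 0 (enum_rank v).
  rewrite -[i]enum_valK -[j]enum_valK; apply: (kerD a) => e eE.
  have /rowP/(_ (enum_rank_in eE e)) := uD; rewrite !mxE; apply: etrans.
  rewrite (sumV (fun v => a v * D v e)); apply: eq_bigr => k _.
  by rewrite !mxE /a enum_valK enum_rankK_in.
have rkB : (#|F| <= \rank MB + 1)%N.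
  rewrite -mxrank_tr; apply: rank_lower_bound => u uB i j.
  pose b f := u 0 (enum_rank_in (enum_valP i) f).
  suff: b (enum_val i) = b (enum_val j) by rewrite /b !enum_valK_in.
  apply: kerB; try exact: enum_valP.
  move=> e eE; have /rowP/(_ (enum_rank_in eE e)) := uB; rewrite !mxE; apply: etrans.
  rewrite big_enum_val; apply: eq_bigr => k _.
  by rewrite !mxE /b enum_valK_in enum_rankK_in // mulrC.
(* One inclusion is DB = 0; equality follows by rank, the [+ 2] in [EVF] absorbing the [+ 1] of each
   rank bound. *)
have kerMB : (kermx MB <= MD)%MS.
  have sDB : (MD <= kermx MB)%MS by exact/sub_kermxP.
  rewrite -(mxrank_leqif_sup sDB) eqn_leq mxrankS //= mxrank_ker.
  rewrite leq_subLR -(leq_add2r 2); apply: leq_trans EVF _.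
  by have := leq_add rkD rkB; rewrite addnACA (addnC (\rank MD)).
have : (\row_i c (enum_val i) <= MD)%MS.
  apply: submx_trans kerMB; apply/sub_kermxP/rowP=> j; rewrite !mxE.
  under eq_bigr do rewrite !mxE.
  rewrite -(big_enum_val (fun e => c e * B e (enum_val j))).
  exact/cB/enum_valP.
case/submxP=> u uc; exists (fun v => u 0 (enum_rank v)) => e eE.
have /rowP/(_ (enum_rank_in eE e)) := uc; rewrite !mxE enum_rankK_in // => ->.
rewrite (sumV (fun v => u 0 (enum_rank v) * D v e)); apply: eq_bigr => k _.
by rewrite !mxE enum_valK enum_rankK_in.
Qed.

Lemma natr_F2_eq0 (n : nat) : (n%:R == 0 :> 'F_2) = ~~ odd n.
Proof. by rewrite -(dvdn_pcharf (pchar_Fp (isT : prime 2))) dvdn2. Qed.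

Lemma natr_F2_addb (a b : bool) : (a (+) b)%:R = a%:R + b%:R :> 'F_2.
Proof. by case: a; case: b; apply: val_inj. Qed.

Lemma addrr_F2 (x : 'F_2) : x + x = 0.
Proof. exact/addrr_pchar2/pchar_Fp. Qed.

End Exactness.

(** * Edges, incidence numbers and rewirings in a combinatorial map *)

Section MapEdges.
Variable M : cmap.
Implicit Types (d : dart M) (e : {set dart M}) (s r : {set {set dart M}}).

Lemma map_edge_in d : map_edge d \in map_edges M.
Proof. exact: imset_f. Qed.

Lemma mem_map_edge d d' : (d' \in map_edge d) = (map_edge d' == map_edge d).
Proof.
apply/idP/eqP=> [|<-]; last by rewrite set21.
by case/set2P=> ->; rewrite // /map_edge drevK setUC.
Qed.

Lemma map_edge_setP s r : s \subset map_edges M -> r \subset map_edges M ->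
  (forall d, (map_edge d \in s) = (map_edge d \in r)) -> s = r.
Proof.
move=> /subsetP sE /subsetP rE sr; apply/setP=> e.
apply/idP/idP=> he; [move: (sE e he) | move: (rE e he)];
  by case/imsetP=> d _ Ed; move: he; rewrite Ed sr.
Qed.

Lemma incident_porbit (p : {perm dart M}) d0 d :
  incident (map_edge d) (porbit p d0) =
  (d \in porbit p d0) || (drev d \in porbit p d0).
Proof.
apply/set0Pn/orP=> [[x /setIP[/set2P[]-> ->]]|[] H]; [by left|by right| |].
  by exists d; rewrite inE set21.
by exists (drev d); rewrite inE set22.
Qed.

Local Open Scope ring_scope.

Lemma big_map_edge (R : zmodType) d (h : dart M -> R) :
  \sum_(x in map_edge d) h x = h d + h (drev d).
Proof. by rewrite big_setU1 ?big_set1 // inE eq_sym drev_neq. Qed.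

Lemma big_map_edges (R : zmodType) (h : dart M -> R) :
  \sum_d h d = \sum_(e in map_edges M) \sum_(d in e) h d.
Proof.
rewrite (partition_big (@map_edge M) (mem (map_edges M))) => [|d _] /=.
  apply: eq_bigr => _ /imsetP[d _ ->]; apply: eq_bigl => d'.
  by rewrite mem_map_edge.
exact: map_edge_in.
Qed.

Lemma natr_degree (R : nzRingType) s (x : {set dart M}) :
  (degree s x)%:R = \sum_(d in x) (map_edge d \in s)%:R :> R.
Proof.
rewrite /degree -sum1_card natr_sum [RHS]big_mkcond [LHS]big_mkcond.
apply: eq_bigr => d _; rewrite inE; case: (d \in x) => //=.
by case: (_ \in s).
Qed.

(** The inner sum is the incidence number of [e] and [x], which is 2 when both darts of [e] lie in
    [x]. *)
Lemma sum_edges_dart (R : nzRingType) (c : {set dart M} -> R) (x : {set dart M}) :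
  \sum_(e in map_edges M) c e * \sum_(d in e) (d \in x)%:R =
  \sum_(d in x) c (map_edge d).
Proof.
rewrite [RHS]big_mkcond big_map_edges /=; apply: eq_bigr => _ /imsetP[d _ ->].
rewrite mulr_sumr; apply: eq_bigr => d'; rewrite mem_map_edge => /eqP ->.
by case: (d' \in x); rewrite ?mulr1 ?mulr0.
Qed.

Local Close Scope ring_scope.

Lemma dC_le1 s r : (dC s r <= 1) = (s == r) || csfr s r.
Proof.
have w0 : csfr_walk 0 s r = (s == r).
  apply/existsP/eqP=> [[p]|->]; last by exists [tuple]; rewrite /= eqxx.
  by rewrite tuple0 /= => /eqP.
have w1 : csfr_walk 1 s r = csfr s r.
  apply/existsP/idP=> [[[[|x [|y p]] hp]] //=|sr].
    by rewrite andbT => /andP[sx /eqP <-].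
  by exists [tuple r]; rewrite /= sr eqxx.
(* Lengths 0 and 1 are then both searched, so a search that fails at both returns at least 2. *)
have : 1 < #|{set {set dart M}}|.
  apply/card_gt1P; exists set0, setT; split=> //.
  by apply/eqP=> /setP/(_ set0); rewrite !inE.
rewrite /dC -w0 -w1; case: #|_| => [|[|n]] //= _.
by case: (csfr_walk 0 s r); case: (csfr_walk 1 s r).
Qed.

(** Over F_2, a rewiring adds the incidence vector of a face to the indicator of [s]. *)
Lemma csfrP s r : s \subset map_edges M -> r \subset map_edges M ->
  reflect (exists2 f, f \in map_faces M &
      forall d, (map_edge d \in r) = (map_edge d \in s) (+) incident (map_edge d) f)
    [exists f in map_faces M, forall e in map_edges M,
      if incident e f then (e \in s) == (e \notin r) else (e \in s) == (e \in r)].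
Proof.
move=> sE rE; apply: (iffP exists_inP) => -[f fF H]; exists f => //.
  move=> d; move/forall_inP: H => /(_ _ (map_edge_in d)).
  by case: ifP => _ /eqP ->; rewrite ?addbT ?addbF ?negbK.
apply/forall_inP=> _ /imsetP[d _ ->]; rewrite H.
by case: incident; rewrite ?addbT ?addbF ?negbK.
Qed.

End MapEdges.

(** * Cuts of G as cycles of the dual *)

Section Cuts.
Variables (G : sgraph) (pi : planar_embedding G).
Local Notation M := (dual_graph pi).
Implicit Types (d : dart M) (A : {set G}).

Lemma gtail_rotation (d : gdart G) : gtail (rotation pi d) = gtail d.
Proof.
have := mem_porbit (rotation pi) 1 d.
by rewrite expg1 rotationP inE => /eqP.
Qed.

(** Here [node M] is the face permutation of the embedding of G, so it walks along a face boundary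
    of G. *)
Lemma gtail_node d : gtail (node M d) = ghead d.
Proof. by rewrite [node M]/= permE gtail_rotation. Qed.

Definition ends d : {set G} := [set gtail d; ghead d].

Lemma ends_in d : ends d \in graph_edges G.
Proof. by apply/imsetP; exists (val (d : gdart G)) => //; rewrite inE; exact: (valP (d : gdart G)). Qed.

Lemma graph_edgeP e : reflect (exists d, e = ends d) (e \in graph_edges G).
Proof.
apply: (iffP imsetP) => [[p pG ->]|[d ->]].
  by rewrite inE in pG; exists (Sub p pG : gdart G).
by exists (val (d : gdart G)) => //; rewrite inE; exact: (valP (d : gdart G)).
Qed.

Lemma gtail_neq_ghead (d : gdart G) : gtail d != ghead d.
Proof. by apply/eqP=> E; have := valP (d : gdart G); rewrite -/(gtail d) E adj_irrefl. Qed.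

Lemma gdart_inj (d d' : gdart G) :
  gtail d = gtail d' -> ghead d = ghead d' -> d = d'.
Proof.
by case: d d' => [[x y] ?] [[x' y'] ?] /= E1 E2; apply/val_inj/(congr2 pair).
Qed.

(** G is simple: a dart is determined by its tail and head, so an edge carries one dart in each
    direction. *)
Lemma eq_ends d d' : (ends d' == ends d) = (d' \in map_edge d).
Proof.
apply/eqP/idP=> [E|/set2P[]-> //]; last by rewrite /ends [RHS]setUC.
have := set21 (gtail d') (ghead d'); have := set22 (gtail d') (ghead d').
rewrite -/(ends d') E !inE => /orP[]/eqP Eh /orP[]/eqP Et.
- by case/eqP: (gtail_neq_ghead d'); rewrite Et Eh.
- by rewrite (_ : d' = drev d) ?eqxx ?orbT //; apply: gdart_inj.
- by rewrite (_ : d' = d) ?eqxx //; apply: gdart_inj.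
- by case/eqP: (gtail_neq_ghead d'); rewrite Et Eh.
Qed.

Lemma dual_edge_ends d : dual_edge pi (ends d) = map_edge d.
Proof. by apply/setP=> d'; rewrite inE -eq_ends. Qed.

Lemma card_map_edges : #|map_edges M| = #|graph_edges G|.
Proof.
have -> : map_edges M = dual_edge pi @: graph_edges G.
  apply/setP=> e; apply/imsetP/imsetP=> [[d _ ->]|[_ /graph_edgeP[d ->] ->]].
    by exists (ends d); rewrite ?ends_in ?dual_edge_ends.
  by exists d; rewrite ?dual_edge_ends.
apply: card_in_imset => _ _ /graph_edgeP[d ->] /graph_edgeP[d' ->].
by rewrite !dual_edge_ends => E; apply/eqP; rewrite eq_ends -E set21.
Qed.

Definition dual_cut A := Psi pi [set A; ~: A].

Lemma ends_in_cutset A d :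
  (ends d \in cutset [set A; ~: A]) = (gtail d \in A) (+) (ghead d \in A).
Proof.
have meet (B : {set G}) : (B :&: ends d != set0) = (gtail d \in B) || (ghead d \in B).
  apply/set0Pn/orP=> [[x /setIP[xB xE]]|[]H].
  - by case/set2P: xE xB => ->; [left|right].
  - by exists (gtail d); rewrite inE H set21.
  - by exists (ghead d); rewrite inE H set22.
rewrite inE ends_in /=; apply/exists_inP/idP=> [[B BP /exists_inP[C CP]]|].
  case/set2P: BP CP => -> /set2P[]->; rewrite ?eqxx // !meet !inE;
  by case: (_ \in A); case: (_ \in A); rewrite // andbF.
move=> H; exists A; rewrite ?set21 //; apply/exists_inP.
exists (~: A); rewrite ?set22 //.
rewrite !meet !inE; apply/and3P; split.
- by apply/eqP=> /setP/(_ (gtail d)); rewrite inE; case: (_ \in A).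
- by move: H; case: (_ \in A); case: (_ \in A).
- by move: H; case: (_ \in A); case: (_ \in A).
Qed.

Lemma mem_dual_cut A d :
  (map_edge d \in dual_cut A) = (gtail d \in A) (+) (ghead d \in A).
Proof.
rewrite -ends_in_cutset; apply/imsetP/idP=> [[e eC]|H]; last first.
  by exists (ends d); rewrite ?dual_edge_ends.
have /graph_edgeP[d' Ee] : e \in graph_edges G by move: eC; rewrite inE => /andP[].
rewrite Ee dual_edge_ends => E; suff /eqP <- : e == ends d by [].
by rewrite Ee eq_ends E set21.
Qed.

Lemma dual_cut_sub A : dual_cut A \subset map_edges M.
Proof.
apply/subsetP=> _ /imsetP[e + ->]; rewrite inE => /andP[/graph_edgeP[d ->] _].
by rewrite dual_edge_ends map_edge_in.
Qed.

Lemma map_vertex_node f d : f \in map_vertices M -> (node M d \in f) = (d \in f).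
Proof.
rewrite /map_vertices /cells; case: eqP => [_ /set1P->|_ /imsetP[d0 _ ->]].
  by rewrite !inE.
by rewrite -!eq_porbit_mem -[X in porbit _ X == _]/((node M ^+ 1)%g d) porbit_perm.
Qed.

(** [node M] permutes the darts of [f] and turns heads into tails of the next darts. *)
Lemma face_boundary_sum (R : zmodType) (h : G -> R) f : f \in map_vertices M ->
  (\sum_(d in f) h (gtail d) = \sum_(d in f) h (ghead d))%R.
Proof.
move=> fM; rewrite (reindex_inj (@perm_inj _ (node M))) /=.
by apply: eq_big => d; rewrite ?map_vertex_node // gtail_node.
Qed.

(** Modulo 2 the degree is the sum of the indicator of [A] over tails plus the same sum over heads;
    the two are equal and cancel. *)
Lemma dual_cut_cycle A : dual_cut A \in cycle_space M.
Proof.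
rewrite inE dual_cut_sub; apply/forall_inP=> f fM.
rewrite -natr_F2_eq0 natr_degree.
under eq_bigr do rewrite mem_dual_cut natr_F2_addb.
rewrite big_split /= (face_boundary_sum (fun v => (v \in A)%:R%R)) //.
by rewrite addrr_F2.
Qed.

End Cuts.

(** * Connectivity, and cycles of the dual as cuts of G *)

Section NashCuts.
Variables (G : sgraph) (G_connected : connected_graph G).
Variable pi : planar_embedding G.
Local Notation M := (dual_graph pi).
Implicit Types (d : dart M) (A : {set G}).

Lemma connected_const (T : Type) (h : G -> T) :
  (forall x y, adj x y -> h x = h y) -> forall x y, h x = h y.
Proof.
move=> hadj x y; have /connectP[p + ->] := G_connected.2 x y.
by elim: p x => //= z p IHp x /andP[/hadj-> /IHp].
Qed.

Lemma dart_of_adj x y : adj x y -> exists d, gtail d = x /\ ghead d = y.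
Proof. by move=> xy; exists (Sub (x, y) xy : gdart G). Qed.

(** This is connectivity of the dual. Invariance under [node M] and reversal gives invariance under
    [rotation], so [h] depends only on the tail and descends to the connected graph G. *)
Lemma connected_dart_const (T : Type) (h : dart M -> T) :
    (forall d, h (drev d) = h d) -> (forall d, h (node M d) = h d) ->
  forall d d', h d = h d'.
Proof.
move=> hrev hnode.
have hrot d : h (rotation pi d) = h d.
  by rewrite -[RHS]hrev -[RHS]hnode [node M]/= permE /= grevK.
have htail d d' : gtail d = gtail d' -> h d = h d'.
  move=> E; have : d' \in porbit (rotation pi) d by rewrite rotationP inE E.
  case/porbitP=> n ->; elim: n => [|n IHn]; first by rewrite expg0 perm1.
  by rewrite expgSr permM hrot.
(* The value of [h] on any dart leaving [x], or [None] if there is no such dart. *)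
pose g x := omap h [pick d : dart M | gtail d == x].
have gE d : g (gtail d) = Some (h d).
  rewrite /g; case: pickP => [d' /eqP/htail <- //|/(_ d)].
  by rewrite eqxx.
have gadj x y : adj x y -> g x = g y.
  by case/dart_of_adj=> d [<- <-]; rewrite gE -hrev -gE.
move=> d d'; apply: Some_inj; rewrite -!gE; exact: connected_const.
Qed.

Local Open Scope ring_scope.

Lemma cycle_space_dual_cut (s : {set {set dart M}}) :
  s \in cycle_space M -> exists A, s = dual_cut pi A.
Proof.
rewrite inE => /andP[sE /forall_inP s_even].
(* Incidence matrices over F_2, counted by darts: an edge with the same face on both sides has
   coefficient 0 there. *)
pose D (v : G) (e : {set dart M}) : 'F_2 := \sum_(d in e) (gtail d == v)%:R.
pose B (e f : {set dart M}) : 'F_2 := \sum_(d in e) (d \in f)%:R.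
have DE (a : G -> 'F_2) d :
    \sum_v a v * D v (map_edge d) = a (gtail d) + a (ghead d).
  have sum1 (x : G) : \sum_v a v * (x == v)%:R = a x.
    rewrite (bigD1 x) //= eqxx mulr1 big1 ?addr0 // => v /negbTE.
    by rewrite eq_sym => ->; rewrite mulr0.
  rewrite -[in RHS]sum1 -[X in _ + X]sum1 -big_split /=.
  by apply: eq_bigr => v _; rewrite /D big_map_edge mulrDr.
have [|||||a aE] := @exact_of_card _ _ _ _ (map_edges M) (map_vertices M) D B
    _ _ _ _ (fun e => (e \in s)%:R).
- move=> f fM v; rewrite sum_edges_dart /D.
  under eq_bigr do rewrite big_map_edge.
  rewrite big_split /= (face_boundary_sum (fun x => (x == v)%:R)) //.
  exact: addrr_F2.
- move=> a aD; apply: connected_const => x y /dart_of_adj[d [<- <-]].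
  apply: (addIr (a (ghead d))); rewrite addrr_F2 -DE.
  exact/aD/map_edge_in.
- move=> b bB f g; rewrite /map_vertices /cells in bB *.
  (* Without darts the dual has a single vertex, the empty cell. *)
  case: eqP bB => [_ _ /set1P-> /set1P-> //|_ bB].
  case/imsetP=> d _ -> /imsetP[d' _ ->].
  have sum1 x : \sum_(f in porbits (node M)) (x \in f)%:R * b f
                = b (porbit (node M) x).
    rewrite (bigD1 (porbit (node M) x)) ?imset_f //= porbit_id mul1r.
    rewrite big1 ?addr0 // => _ /andP[/imsetP[y _ ->]].
    by rewrite eq_sym eq_porbit_mem => /negbTE->; rewrite mul0r.
  apply: (connected_dart_const (h := fun x => b (porbit (node M) x))) => x.
    apply: (addIr (b (porbit (node M) x))); rewrite addrr_F2 addrC.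
    rewrite -!sum1 -big_split /=; apply: etrans (bB _ (map_edge_in x)).
    by apply: eq_bigr => h _; rewrite /B big_map_edge mulrDl.
  by have := porbit_perm (node M) 1 x; rewrite expg1 => ->.
(* The vertices of the dual are by definition the faces of the rotation map, so this is Euler's
   formula. *)
- by rewrite card_map_edges -(eulerP pi).
- move=> f /s_even; rewrite -natr_F2_eq0 natr_degree => /eqP; apply: etrans.
  exact: (sum_edges_dart (fun e => (e \in s)%:R)).
(* The support of the potential [a] is one side of the cut: [a (gtail d) + a (ghead d)] is 1 exactly
   when the edge is separated. *)
exists [set v | a v != 0]; apply: map_edge_setP => //.
  exact: dual_cut_sub.
move=> d; rewrite mem_dual_cut !inE; have := aE _ (map_edge_in d).
rewrite DE; move: (a _) (a _) => [[|[|x]] hx] [[|[|y]] hy] //;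
by case: (_ \in s) => // /(congr1 val).
Qed.

Local Close Scope ring_scope.

(** * Rewirings as moves of a single vertex across the cut *)

Definition flip (v : G) A : {set G} := [set x | (x \in A) (+) (x == v)].

(** The boundary edges of the face of the dual that corresponds to [v]; empty when [v] is
    isolated. *)
Definition star (v : G) : {set {set dart M}} :=
  [set map_edge d | d : dart M & gtail d == v].

Lemma mem_star v d : (map_edge d \in star v) = (gtail d == v) || (ghead d == v).
Proof.
apply/imsetP/orP=> [[d' + E]|[H|H]].
- have : d \in map_edge d' by rewrite mem_map_edge E.
  by case/set2P=> -> ; rewrite inE; [left|right].
- by exists d; rewrite ?inE.
by exists (drev d); rewrite ?inE //; apply/esym/eqP; rewrite -mem_map_edge set22.
Qed.

(** An edge has no loop at [v], so moving [v] toggles the side of at most one end. *)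
Lemma mem_dual_cut_flip A v d :
  (map_edge d \in dual_cut pi (flip v A)) =
  (map_edge d \in dual_cut pi A) (+) (map_edge d \in star v).
Proof.
rewrite !mem_dual_cut mem_star !inE addbACA; congr (_ (+) _).
have := gtail_neq_ghead d.
by case: (gtail d =P v) => [->|_]; case: (ghead d =P v) => [->|_]; rewrite ?eqxx.
Qed.

(** The faces of the dual are the orbits of [rotation], that is, the sets of darts with a common
    tail. *)
Lemma incident_face d0 d :
  incident (map_edge d) (porbit (face M) d0) = (map_edge d \in star (gtail d0)).
Proof.
by rewrite incident_porbit mem_star face_dual_map [node _]/= rotationP !inE.
Qed.

Lemma GammaC_dual_cut A r :
  r \in GammaC (dual_cut pi A) <->
  r = dual_cut pi A \/ exists v, r = dual_cut pi (flip v A).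
Proof.
rewrite inE dC_le1; split.
  case/andP=> _ /orP[/eqP->|/and3P[_ rC]]; first by left.
  have rE : r \subset map_edges M by move: rC; rewrite inE => /andP[].
  case/(csfrP (dual_cut_sub pi A) rE)=> f + rf; rewrite /map_faces /cells.
  (* Without darts the only face is empty and the rewiring changes nothing; otherwise the face is
     that of the tail of a dart [d0]. *)
  case: eqP => [_ /set1P f0|_ /imsetP[d0 _ f0]]; [left|right; exists (gtail d0)];
    apply: map_edge_setP; rewrite ?dual_cut_sub // => d; rewrite rf f0.
    by rewrite /incident setI0 eqxx addbF.
  by rewrite incident_face mem_dual_cut_flip.
case=> [->|[v ->]]; rewrite dual_cut_cycle ?eqxx // andTb.
case: (pickP (fun d => gtail d == v)) => [d0 /eqP Ev|nov].
  apply/orP; right; rewrite /csfr !dual_cut_cycle !andTb.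
  apply/(csfrP (dual_cut_sub pi _) (dual_cut_sub pi _)); exists (porbit (face M) d0) => [|d].
    rewrite /map_faces /cells; case: eqP => [/setP/(_ (porbit (face M) d0))|_].
      by rewrite imset_f ?inE.
    exact: imset_f.
  by rewrite incident_face Ev mem_dual_cut_flip.
(* An isolated [v] has an empty star, so moving it leaves the cut unchanged. *)
apply/orP; left; apply/eqP; apply: map_edge_setP; rewrite ?dual_cut_sub // => d.
by rewrite mem_dual_cut_flip mem_star nov (nov (drev d)) addbF.
Qed.

(** Both sides count the darts leaving [v]: since G is simple, these correspond to the edges at [v]
    and to its neighbours. *)
Lemma card_star_cut A v b :
  #|[set e in star v | (e \in dual_cut pi A) == b]| =
  #|[set x | adj v x & ((v \in A) (+) (x \in A)) == b]|.
Proof.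
pose N := [set d : dart M | (gtail d == v) && ((map_edge d \in dual_cut pi A) == b)].
transitivity #|N|.
  rewrite -(card_in_imset (f := @map_edge M) (D := mem N)).
    congr #|pred_of_set _|; apply/setP=> e; rewrite !inE.
    apply/andP/imsetP=> [[/imsetP[d + ->] Hb]|[d + ->]]; rewrite inE.
      by move=> Hd; exists d; rewrite // inE Hd.
    by case/andP=> Hd Hb; split=> //; apply/imsetP; exists d; rewrite ?inE.
  move=> d d'; rewrite !inE => /andP[/eqP Ed _] /andP[/eqP Ed' _] E.
  have : d' \in map_edge d by rewrite mem_map_edge E.
  case/set2P=> // Erev; have := gtail_neq_ghead d.
  by rewrite -[ghead d]/(gtail (drev d : gdart G)) -Erev Ed Ed' eqxx.
rewrite -(card_in_imset (f := fun d : dart M => ghead d) (D := mem N)).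
  congr #|pred_of_set _|; apply/setP=> x; rewrite !inE.
  apply/imsetP/andP=> [[d + ->]|[/dart_of_adj[d [Ed Ex]] Hb]].
    rewrite inE mem_dual_cut => /andP[/eqP <- ->]; split=> //.
    exact: (valP (d : gdart G)).
  by exists d; rewrite ?inE ?mem_dual_cut ?Ed ?Ex ?eqxx.
move=> d d'; rewrite !inE => /andP[/eqP Ed _] /andP[/eqP Ed' _] E.
by apply: gdart_inj; rewrite ?Ed ?Ed'.
Qed.

(** The two cuts agree outside the star of [v] and are complementary inside it, so only the edges at
    [v] are compared. *)
Lemma leq_card_dual_cut_flip A v :
  (#|dual_cut pi A| <= #|dual_cut pi (flip v A)|) =
  (#|[set x | adj v x & ((v \in A) (+) (x \in A)) == true]| <=
   #|[set x | adj v x & ((v \in A) (+) (x \in A)) == false]|).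
Proof.
rewrite -!card_star_cut -(cardsID (star v)) -[leqRHS](cardsID (star v)).
have flipE e : e \in map_edges M ->
    (e \in dual_cut pi (flip v A)) = (e \in dual_cut pi A) (+) (e \in star v).
  by case/imsetP=> d _ ->; apply: mem_dual_cut_flip.
have starE e : e \in star v -> e \in map_edges M.
  by case/imsetP=> d _ ->; apply: map_edge_in.
have -> : dual_cut pi (flip v A) :\: star v = dual_cut pi A :\: star v.
  apply/setP=> e; rewrite !inE; case: (boolP (e \in star v)) => //= Hs.
  apply/idP/idP=> H.
    have := H; rewrite flipE ?(negbTE Hs) ?addbF //.
    exact: (subsetP (dual_cut_sub pi _) _ H).
  rewrite flipE ?(negbTE Hs) ?addbF //.
  exact: (subsetP (dual_cut_sub pi _) _ H).
rewrite leq_add2r; congr (_ <= _); apply: eq_card => e; rewrite !inE.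
  by rewrite eqb_id andbC.
rewrite andbC; case: (boolP (e \in star v)) => //= Hs.
by rewrite flipE ?starE // Hs addbT eqbF_neg.
Qed.

(** * Payoffs and locally minimal cuts *)

Lemma payoffE (v : G) (i : 'I_2) (u : profile G) :
  payoff v i u = #|[set x | adj v x & i == u x]|.
Proof.
rewrite /payoff -sum1_card [RHS]big_mkcond; apply: eq_bigr => x _.
by rewrite inE /adjacency; case: (adj v x); case: (i == u x).
Qed.

(** With two strategies, the neighbours of [v] on its own side count its payoff and those across the
    cut count the payoff of its only deviation. *)
Lemma nash_dual_cut (u : profile G) (A := [set v | u v == ord0]) :
  (forall r, r \in GammaC (dual_cut pi A) -> #|dual_cut pi A| <= #|r|) <-> nash u.
Proof.
have flip_payoff v i : i != u v ->
    (#|dual_cut pi A| <= #|dual_cut pi (flip v A)|) =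
    (payoff v i u <= payoff v (u v) u).
  move=> iv; rewrite leq_card_dual_cut_flip !payoffE.
  congr (_ <= _); apply: eq_card => x; rewrite !inE; congr (_ && _);
  by case: (u v) iv => [[|[|]]] //; case: i => [[|[|]]] //; case: (u x) => [[|[|]]].
split=> [min_s v i|u_nash r].
  have [-> //|/flip_payoff <-] := eqVneq i (u v).
  by apply: min_s; apply/GammaC_dual_cut; right; exists v.
case/GammaC_dual_cut=> [->//|[v ->]].
have [i iv] : exists i, i != u v.
  by case: (u v) => [[|k] hk]; [exists ord_max|exists ord0].
by rewrite (flip_payoff v i iv).
Qed.

End NashCuts.

(** * Passage to classes of profiles *)

Theorem theorem4p1 (G : sgraph) (G_connected : connected_graph G)
    (pi : planar_embedding G) (s : {set {set dart (dual_graph pi)}})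
    (s_cycle : s \in cycle_space (dual_graph pi)) :
  (forall r : {set {set dart (dual_graph pi)}}, r \in GammaC s -> #|s| <= #|r|)
  <-> nash_class (Phi_inv (Psi_inv s)).
Proof.
(* As every cycle is a dual cut, the choice in [Psi_inv] succeeds and never falls back on its
   default. *)
have [P PQ sP] : exists2 P, P \in Q2 G & s = Psi pi P /\ Psi_inv s = P.
  rewrite /Psi_inv; case: pickP => [P /andP[PQ /eqP sP]|none]; first by exists P.
  have [A sA] := cycle_space_dual_cut G_connected s_cycle.
  have AQ : [set A; ~: A] \in Q2 G by apply: imset_f.
  by have := none [set A; ~: A]; rewrite AQ sA eqxx.
case: sP => -> ->; split=> [min_s|[u]].
  (* Any profile in the fibre of [P] has [s] as its dual cut, so a single representative decides the
     class. *)
  have [u uP] := strategy_partition_surj PQ; exists u; first by rewrite !inE uP.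
  by apply/(nash_dual_cut pi); rewrite /dual_cut -strategy_partitionE uP.
by rewrite !inE => /eqP <- /(nash_dual_cut pi); rewrite /dual_cut -strategy_partitionE; apply.
Qed.
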